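(* There exist a metrizable space $Z$, an equiconnected subspace $Z_1$ of $Z$ and a function $g:[0,1]\to Z$ of the first Baire class such that the following conditions hold: (1) there exists a sequence of continuous functions $g_n:[0,1]\to Z_1$ which converges to $g$ pointwise on $[0,1]$; (2) the function $g$ is not the diagonal of any separately continuous function $f:[0,1]^2\to Z$, that is, there is no separately continuous $f:[0,1]^2\to Z$ with $f(x,x)=g(x)$ for all $x\in[0,1]$.
   Context: A function is of the first Baire class if it is the pointwise limit of a sequence of continuous functions (with the same domain and target space). A function on $[0,1]^2$ is separately continuous if it is continuous with respect to each variable when the other one is fixed. A topological space $Z_1$ is equiconnected if there exists a continuous mapping $\lambda:Z_1\times Z_1\times[0,1]\to Z_1$ such that $\lambda(x,y,0)=\lambda(y,x,1)=x$ for all $x,y\in Z_1$ and $\lambda(x,x,t)=x$ for all $x\in Z_1$ and $t\in[0,1]$. An equiconnected subspace of $Z$ is a subset of $Z$ which is equiconnected in its subspace topology. *)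

(* Defs.v *)
From mathcomp Require Import all_boot all_order all_algebra.
From mathcomp Require Import all_classical all_reals all_analysis.

Set Implicit Arguments.
Unset Strict Implicit.
Unset Printing Implicit Defensive.

Import Order.TTheory GRing.Theory Num.Theory.
Import numFieldNormedType.Exports.

Local Open Scope classical_set_scope.
Local Open Scope ring_scope.

(* A set [A : set T] coerces to the type [set_type A] of its elements, which
   carries the topology induced from [T]; [unit_interval R] and the subspace
   [Z1] of the main statement are both used as topological spaces this way. *)
Definition unit_interval (R : realType) : set R := `[0, 1]%classic.
Arguments unit_interval R : clear implicits.

Lemma unit_interval0 (R : realType) : (0 : R) \in unit_interval R.
Proof. by apply/mem_set; rewrite /unit_interval /= in_itv /= lexx ler01. Qed.

Lemma unit_interval1 (R : realType) : (1 : R) \in unit_interval R.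
Proof. by apply/mem_set; rewrite /unit_interval /= in_itv /= lexx ler01. Qed.

Definition ui0 (R : realType) : unit_interval R :=
  exist _ (0 : R) (unit_interval0 R).

Definition ui1 (R : realType) : unit_interval R :=
  exist _ (1 : R) (unit_interval1 R).

Definition metrizable (R : realType) (T : topologicalType) : Prop :=
  exists d : T -> T -> R,
    [/\ forall x y, 0 <= d x y,
        forall x y, d x y = 0 <-> x = y,
        forall x y, d x y = d y x,
        forall x y z, d x z <= d x y + d y z
      & forall (x : T) (A : set T),
          nbhs x A <-> exists2 e : R, 0 < e & [set y | d x y < e] `<=` A].

Lemma metric_metrizable (R : realType) (T : metricType R) : metrizable R T.
Proof.
exists (@mdist R T); split.
- exact: mdist_ge0.
- by move=> x y; split=> [/mdist_positivity//|->]; rewrite mdistxx.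
- exact: metric_sym.
- by move=> x y z; exact: metric_triangle.
- move=> x A; split.
  + by move/nbhs_ballP => [e e0 eA]; exists e => //; rewrite -ballEmdist.
  + by move=> [e e0 eA]; apply/nbhs_ballP; exists e => //; rewrite ballEmdist.
Qed.

Definition equiconnected (R : realType) (T : topologicalType) : Prop :=
  exists lambda : T * T * unit_interval R -> T,
    [/\ continuous lambda,
        forall x y, lambda (x, y, ui0 R) = x,
        forall x y, lambda (y, x, ui1 R) = x
      & forall x t, lambda (x, x, t) = x].

Definition first_baire_class (X Y : topologicalType) (f : X -> Y) : Prop :=
  exists f_ : nat -> X -> Y,
    (forall n, continuous (f_ n)) /\
    (forall x, f_ n x @[n --> \oo] --> f x).

Definition separately_continuous (X Y Z : topologicalType)
    (f : X * Y -> Z) : Prop :=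
  (forall x, continuous (fun y => f (x, y))) /\
  (forall y, continuous (fun x => f (x, y))).

(* Main.v *)
(* Take for Z the topologist's sine curve, with the negative half-axis attached
   at the origin, and for Z1 its open oscillating branch, which is homeomorphic
   to the half-line (0, +oo), hence equiconnected. The points with abscissa
   1/((n+1) pi) of Z1 lie on the axis and tend to the origin, so the step
   function g equal to the origin at 0 and to (1, sin 1) elsewhere is a
   pointwise limit of continuous ramps in Z1. If g were the diagonal of a
   separately continuous f, then f(0, -) followed by f(-, 1) would be a path in
   Z from the origin to Z1; there is none. *)
Require Import Defs.
From mathcomp Require Import all_boot all_order all_algebra.
From mathcomp Require Import all_classical all_reals all_analysis.
From mathcomp Require Import lra.
From HB Require Import structures.
Import Order.TTheory GRing.Theory Num.Theory.
Import numFieldNormedType.Exports.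
Local Open Scope classical_set_scope.
Local Open Scope ring_scope.

(** * The oscillation of [sin (1/x)] near 0 *)

Definition sin_inv {R : realType} (x : R) : R := if 0 < x then sin x^-1 else 0.

Lemma sin_inv_le0 (R : realType) (x : R) : x <= 0 -> sin_inv x = 0.
Proof. by rewrite /sin_inv ltNge => ->. Qed.

Lemma continuous_sin_inv (R : realType) (x : R) :
  0 < x -> {for x, continuous (@sin_inv R)}.
Proof.
move=> x0; have : {for x, continuous (fun y : R => sin y^-1)}.
  apply: (@continuous_comp R R R GRing.inv sin); last exact: continuous_sin.
  by apply: inv_continuous; rewrite gt_eqF.
rewrite /continuous_at [X in _ --> X -> _](_ : _ = sin_inv x); last first.
  by rewrite /sin_inv x0.
apply: cvg_trans; apply: near_eq_cvg; near=> y.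
rewrite /sin_inv ifT //; near: y; exact: lt_nbhsr.
Unshelve. all: by end_near. Qed.

Lemma sin_inv_eq1 (R : realType) (e : R) :
  0 < e -> exists x, [/\ 0 < x, x < e & sin_inv x = 1].
Proof.
move=> e0; have p0 := pi_gt0 R.
(* Since [2 pi >= 1], adding [n + 1 > 1/e] periods to [pi / 2] gives a point beyond [1/e] where the
   sine is 1; its inverse is the witness. *)
pose n := Num.trunc e^-1; pose y : R := pi / 2 + pi *+ 2 *+ n.+1.
have ey : e^-1 < y.
  have := truncnS_gt e^-1; rewrite -/n => /lt_trans; apply.
  have p2 := pi_ge2 R.
  rewrite /y -[X in X < _]mul1r mulr_natr -[ltLHS]add0r.
  apply: ltr_leD; first lra.
  by rewrite lerMn2r; apply/orP; right; rewrite mulr2n; lra.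
have y0 : 0 < y by apply: lt_trans ey; rewrite invr_gt0.
exists y^-1; split; first by rewrite invr_gt0.
  by rewrite -[e]invrK ltf_pV2 ?posrE ?invr_gt0.
rewrite /sin_inv invr_gt0 y0 invrK /y periodicn ?sin_pihalf //; exact: sinD2pi.
Qed.

Lemma sin_inv_harmonic_pi (R : realType) (n : nat) :
  sin_inv (pi *+ n.+1 : R)^-1 = 0.
Proof.
rewrite /sin_inv; case: ifP => // _.
by rewrite invrK -[pi *+ _]add0r (alternatingn (@sinDpi R)) sin0 mulr0.
Qed.

(* The set [p t <= 0] is clopen: near one of its points [sin_inv \o p] stays
   below 1, whereas reaching a positive abscissa would force the value 1. *)
Lemma sin_inv_no_crossing (R : realType) (p : R -> R) :
  continuous p -> continuous (sin_inv \o p) -> p 0 <= 0 -> forall t, p t <= 0.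
Proof.
move=> cp cq p0 t; suff pT : [set t | p t <= 0] = setT.
  by have : setT t by []; rewrite -pT.
have : connected [set: R] by apply/connected_intervalP.
apply; first by exists 0.
- exists [set t | p t <= 0]; last by rewrite setTI.
  rewrite openE => s /= ps; rewrite /interior.
  have := cq s; rewrite /continuous_at /= sin_inv_le0 // => /cvgr0_norm_lt.
  move=> /(_ 1 ltr01) /nbhs_ballP[e /= e0 he].
  apply/nbhs_ballP; exists e => //= u su; rewrite /= leNgt; apply/negP => pu.
  have [x [x0 xpu hx]] := @sin_inv_eq1 R _ pu.
  (* The peak [x] lies between [p s <= 0] and [p u]. As [u] may be on either side of [s], the
     interval is written with min and max; [c] stays in the ball around [s] where [sin_inv \o p] has
     absolute value below 1. *)
  have [c cst pc] : exists2 c, c \in `[Num.min s u, Num.max s u] & p c = x.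
    apply: IVT; first by rewrite ge_min !le_max !lexx.
      exact: continuous_subspaceT.
    by case: (leP s u) => _; rewrite ge_min le_max; lra.
  have /he /= : ball s e c.
    move: su cst; rewrite /ball /= in_itv /= !ltr_norml.
    by case: (leP s u); lra.
  by rewrite pc hx normr1 ltxx.
- exists [set t | p t <= 0]; last by rewrite setTI.
  by apply: (@closed_comp _ _ p [set x | x <= 0]) => //; exact: closed_le.
Qed.

(* The curve is carried by the type [R] of abscissas, with the topology pulled
   back from the plane along the graph map. *)
Definition graph_sin_inv {R : realType} (x : R) : R * R := (x, sin_inv x).

Definition sine_curve (R : realType) : Type :=
  initial_topology (@graph_sin_inv R).

HB.instance Definition _ (R : realType) :=
  PseudoMetric.copy (sine_curve R) (initial_topology (@graph_sin_inv R)).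

(** * Coordinates, convergence and metric on the curve *)

Section SineCurve.
Context {R : realType}.

Definition abscissa (z : sine_curve R) : R := z.

Lemma continuous_abscissa : continuous abscissa.
Proof.
move=> z; apply: (@continuous_comp _ _ _
  (@graph_sin_inv R : sine_curve R -> _) fst).
  exact: initial_continuous.
exact: cvg_fst.
Qed.

Lemma continuous_ordinate : continuous (sin_inv \o abscissa).
Proof.
move=> z; apply: (@continuous_comp _ _ _
  (@graph_sin_inv R : sine_curve R -> _) snd).
  exact: initial_continuous.
exact: cvg_snd.
Qed.

(** Open sets of the initial topology are preimages of open sets [W] of the plane, so convergence
    can be tested on the two coordinates. *)
Lemma cvg_sine_curve (T : Type) (F : set_system T) (u : T -> sine_curve R)
    (z : sine_curve R) : Filter F ->
  abscissa (u t) @[t --> F] --> abscissa z ->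
  sin_inv (abscissa (u t)) @[t --> F] --> sin_inv (abscissa z) -> u @ F --> z.
Proof.
move=> FF ua uo U [/= V [[W oW <-]]] /= Wz /filterS; apply.
have : nbhs (graph_sin_inv z) W by exact: open_nbhs_nbhs.
exact: (cvg_pair ua uo).
Qed.

Lemma sine_curve_metrizable : metrizable R (sine_curve R).
Proof.
(* The max metric of the plane: its balls are products of intervals, hence exactly the balls pulled
   back along the graph map. It separates points because the abscissa determines the point. *)
pose d (x y : sine_curve R) := Num.max `|abscissa x - abscissa y|
  `|sin_inv (abscissa x) - sin_inv (abscissa y)|.
exists d; split.
- by move=> x y; rewrite /d le_max normr_ge0.
- move=> x y; split=> [dxy|->]; last by rewrite /d !subrr normr0 maxxx.
  have : `|abscissa x - abscissa y| <= 0 by rewrite -dxy /d le_max lexx.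
  by rewrite normr_le0 subr_eq0 => /eqP.
- by move=> x y; rewrite /d distrC [X in Num.max _ X]distrC.
- move=> x y z; rewrite /d ge_max.
  have dle (a b c s t : R) :
      `|a - b| <= s -> `|b - c| <= t -> `|a - c| <= s + t.
    by move=> ab bc; apply: le_trans (ler_distD b a c) _; exact: lerD.
  by apply/andP; split; [apply: (dle _ (abscissa y))|
    apply: (dle _ (sin_inv (abscissa y)))]; rewrite le_max lexx ?orbT.
- move=> x A.
  have ballE e : ball x e = [set y | d x y < e].
    by apply/seteqP; split=> y; rewrite /d /= gt_max => /andP.
  split.
  + by move/nbhs_ballP => [e e0 eA]; exists e; rewrite // -ballE.
  + by move=> [e e0 eA]; apply/nbhs_ballP; exists e; rewrite //= ballE.
Qed.

(** * Paths in the curve *)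

Lemma clamp_subproof (t : R) : Num.max 0 (Num.min 1 t) \in unit_interval R.
Proof.
apply/mem_set; rewrite /unit_interval /= in_itv /=.
by rewrite le_max lexx ge_max ler01 ge_min lexx.
Qed.

(** Retraction of the line onto the unit interval; it extends a path to all of [R], where
    [sin_inv_no_crossing] applies. *)
Definition clamp (t : R) : unit_interval R :=
  exist _ (Num.max 0 (Num.min 1 t)) (clamp_subproof t).

Lemma continuous_clamp : continuous clamp.
Proof.
apply: continuous_comp_initial => t.
apply: (@continuous_max R R (cst 0) (Num.min 1)); first exact: cvg_cst.
by apply: (@continuous_min R R (cst 1) id); [exact: cvg_cst|exact: cvg_id].
Qed.

Lemma unit_intervalP (t : unit_interval R) : 0 <= set_val t <= 1.
Proof. by have := set_valP t; rewrite /unit_interval /= in_itv. Qed.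

Lemma clampK (t : unit_interval R) : clamp (set_val t) = t.
Proof.
apply: val_inj => /=; have /andP[t0 t1] := unit_intervalP t.
by rewrite (min_idPr t1) (max_idPr t0).
Qed.

Lemma path_sine_curve_le0 (c : unit_interval R -> sine_curve R) :
  continuous c -> abscissa (c (ui0 R)) <= 0 -> forall t, abscissa (c t) <= 0.
Proof.
move=> cc c0 t; rewrite -[t]clampK.
apply: (@sin_inv_no_crossing R (fun u => abscissa (c (clamp u)))).
- move=> u; apply: (@continuous_comp _ _ _ (c \o clamp) abscissa).
    by apply: continuous_comp; [exact: continuous_clamp|exact: cc].
  exact: continuous_abscissa.
- move=> u; apply: (@continuous_comp _ _ _ (c \o clamp) (sin_inv \o abscissa)).
    by apply: continuous_comp; [exact: continuous_clamp|exact: cc].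
  exact: continuous_ordinate.
- by rewrite (_ : clamp 0 = ui0 R)// -[RHS]clampK.
Qed.

(** * The oscillating branch and its equiconnectedness *)

Definition right_branch : set (sine_curve R) := [set z | 0 < abscissa z].

(** On positive abscissas the ordinate depends continuously on the abscissa, so the latter alone
    controls continuity. *)
Lemma continuous_right_branch (T : topologicalType) (u : T -> right_branch) :
  continuous (fun t => abscissa (set_val (u t))) -> continuous u.
Proof.
move=> cu; apply: continuous_comp_initial => t.
apply: cvg_sine_curve; first exact: cu.
apply: (@continuous_comp _ _ _ (fun t => abscissa (set_val (u t))) sin_inv).
  exact: cu.
by apply: continuous_sin_inv; exact: (set_valP (u t)).
Qed.

Lemma convex_comb_gt0 (x y t : R) : 0 < x -> 0 < y -> 0 <= t <= 1 ->
  0 < (1 - t) * x + t * y.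
Proof. by move=> x0 y0 /andP[t0 t1]; nra. Qed.

Local Notation segment_data :=
  (right_branch * right_branch * unit_interval R)%type.

Lemma right_branch_comb_subproof (p : segment_data) :
  ((1 - set_val p.2) * abscissa (set_val p.1.1) +
   set_val p.2 * abscissa (set_val p.1.2) : sine_curve R) \in right_branch.
Proof.
apply/mem_set; have p1 := set_valP p.1.1; have p2 := set_valP p.1.2.
exact: (convex_comb_gt0 _ _ _ p1 p2 (unit_intervalP p.2)).
Qed.

(** The affine homotopy of the half-line, carried to the branch through abscissas. *)
Definition right_branch_comb (p : segment_data) : right_branch :=
  exist (fun z => z \in right_branch) _ (right_branch_comb_subproof p).

Lemma right_branch_equiconnected : equiconnected R right_branch.
Proof.
exists right_branch_comb; split.
- apply: continuous_right_branch => p.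
  have ct : {for p, continuous (fun p : segment_data => set_val p.2 : R)}.
    apply: (@continuous_comp _ _ _ snd set_val); first exact: cvg_snd.
    exact: initial_continuous.
  have ca (q : right_branch) :
      {for q, continuous (fun q : right_branch => abscissa (set_val q))}.
    apply: (@continuous_comp _ _ _ set_val abscissa).
      exact: initial_continuous.
    exact: continuous_abscissa.
  have c1 : {for p, continuous (fun p : segment_data => p.1)}.
    exact: cvg_fst.
  apply: cvgD; apply: cvgM => //.
  + by apply: cvgB => //; exact: cvg_cst.
  + apply: (@continuous_comp _ _ _ (fun p : segment_data => p.1.1)
      (fun q : right_branch => abscissa (set_val q))) => //.
    by apply: (continuous_comp c1); exact: cvg_fst.
  + apply: (@continuous_comp _ _ _ (fun p : segment_data => p.1.2)
      (fun q : right_branch => abscissa (set_val q))) => //.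
    by apply: (continuous_comp c1); exact: cvg_snd.
- by move=> x y; apply: val_inj; rewrite /= subr0 mul1r mul0r addr0.
- by move=> x y; apply: val_inj; rewrite /= subrr mul1r mul0r add0r.
- by move=> x t; apply: val_inj; rewrite /= -mulrDl subrK mul1r.
Qed.

(** * Ramps converging to the step function *)

Lemma ramp_subproof (n : nat) (t : unit_interval R) :
  (Num.min 1 ((pi *+ n.+1)^-1 + n%:R * set_val t) : sine_curve R) \in
  right_branch.
Proof.
have /andP[t0 _] := unit_intervalP t.
apply/mem_set; rewrite /right_branch /abscissa /= lt_min ltr01 /=.
by rewrite ltr_pwDl ?mulr_ge0// invr_gt0 pmulrn_lgt0 ?pi_gt0.
Qed.

(** The starting abscissa is a positive zero of [sin_inv]; the slope [n] drives every fixed [t > 0]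
    to the cap 1 eventually. *)
Definition ramp n (t : unit_interval R) : right_branch :=
  exist (fun z => z \in right_branch) _ (ramp_subproof n t).

Lemma abscissa_ramp n (t : unit_interval R) :
  abscissa (set_val (ramp n t)) =
  Num.min 1 ((pi *+ n.+1)^-1 + n%:R * set_val t).
Proof. by []. Qed.

Lemma continuous_ramp n : continuous (ramp n).
Proof.
apply: continuous_right_branch => t.
apply: (@continuous_min R _ (cst 1)
  (fun t : unit_interval R => (pi *+ n.+1)^-1 + n%:R * set_val t)).
  exact: cst_continuous.
apply: (@continuousD R R _ (cst _)); first exact: cst_continuous.
apply: (@continuousM R _ (cst _)); first exact: cst_continuous.
exact: initial_continuous.
Qed.

Definition step (t : unit_interval R) : sine_curve R :=
  if 0 < set_val t then 1 else 0.

Lemma cvg_ramp t : set_val (ramp n t) @[n --> \oo] --> step t.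
Proof.
rewrite /step; case: ifPn => t0.
  (* Once [n >= 1/t] the cap is reached and the sequence is constant. *)
  apply: cvg_near_cst; near=> n.
  rewrite -[LHS]/(abscissa (set_val (ramp n t))) abscissa_ramp min_l//.
  have nt : (set_val t)^-1 <= n%:R by near: n; exact: nbhs_infty_ger.
  rewrite -[leLHS]add0r; apply: lerD.
    by rewrite invr_ge0 mulrn_wge0// pi_ge0.
  by rewrite -ler_pdivrMr// mul1r.
have {}t0 : set_val t = 0.
  apply/eqP; rewrite eq_le leNgt t0 /=.
  by case/andP: (unit_intervalP t).
(* At 0 the cap is inactive because [pi (n + 1) >= 1]; abscissas then decrease to 0 along zeros of
   [sin_inv], so the ordinates converge too. *)
have rampE n : abscissa (set_val (ramp n t)) = (pi *+ n.+1)^-1.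
  rewrite abscissa_ramp t0 mulr0 addr0 min_r//.
  have pn : 1 <= (pi : R) *+ n.+1.
    rewrite mulrS -[leLHS]addr0; apply: lerD.
      by have := pi_ge2 R; lra.
    by rewrite mulrn_wge0// pi_ge0.
  by rewrite invf_le1// (lt_le_trans ltr01).
apply: cvg_sine_curve; under eq_fun => n do rewrite rampE.
- have -> : (fun n => (pi *+ n.+1)^-1) = (fun n => pi^-1 * n.+1%:R^-1 : R).
    by apply/funext => n; rewrite -[in LHS](mulr_natr pi n.+1) invfM.
  have := @cvgM R nat \oo _ _ _ _ _ (cvg_cst pi^-1) (@cvg_harmonic R).
  by rewrite mulr0; apply.
- under eq_fun => n do rewrite sin_inv_harmonic_pi.
  by rewrite sin_inv_le0//; exact: cvg_cst.
Unshelve. all: by end_near. Qed.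

End SineCurve.

Theorem proposition4p1 (R : realType) :
  exists (Z : topologicalType) (Z1 : set Z) (g : unit_interval R -> Z),
    [/\ metrizable R Z,
        equiconnected R Z1,
        first_baire_class g,
        exists g_ : nat -> unit_interval R -> Z1,
          (forall n, continuous (g_ n)) /\
          (forall x, set_val (g_ n x) @[n --> \oo] --> g x)
      & ~ exists f : unit_interval R * unit_interval R -> Z,
            separately_continuous f /\ (forall x, f (x, x) = g x)].
Proof.
exists (sine_curve R), right_branch, step; split.
- exact: sine_curve_metrizable.
- exact: right_branch_equiconnected.
- exists (fun n t => set_val (ramp n t)); split; last exact: cvg_ramp.
  move=> n t; apply: (@continuous_comp _ _ _ (ramp n) set_val).
    exact: continuous_ramp.
  exact: initial_continuous.
- by exists ramp; split; [exact: continuous_ramp|exact: cvg_ramp].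
- move=> [f [[f1 f2] fg]].
  have f00 : abscissa (f (ui0 R, ui0 R)) <= 0 by rewrite fg /step /= ltxx.
  (* The corner [(0, 1)] joins the two paths: its image has nonpositive abscissa, which [f(-, 1)]
     then keeps up to [(1, 1)], where [g] has abscissa 1. *)
  have f01 := path_sine_curve_le0 _ (f1 (ui0 R)) f00 (ui1 R).
  have := path_sine_curve_le0 _ (f2 (ui1 R)) f01 (ui1 R).
  by rewrite fg /step /= ltr01 /abscissa ler10.
Qed.
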